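(* Let $n,N\in\mathbb{N}$ with $n\le N$ and let $e_p(\lambda)$, $p\in\mathbb{N}_0$, be local errors, i.e. nonnegative functions of the wavelet index $\lambda$ such that $e_0(\lambda)\ge e_0(\eta_1)+e_0(\eta_2)$ whenever $\eta_1,\eta_2$ are the children of $\lambda$, and $e_p(\lambda)\ge e_{p+1}(\lambda)$ for all $p\in\mathbb{N}_0$ and all $\lambda$. Then the algorithm NEARBEST_TREE, run for $N$ steps, with a subsequent trimming, finds a quarklet tree $T_N=(\mathcal{T}_N,\mathcal{T}'_N)$ such that $$\mathcal{E}(T_N)\le \frac{2N+1}{N-n+1}\,\sigma_n .$$
   Context: **Wavelet indices and trees.** A wavelet index is a pair $\lambda=(j,k)$ with $j\in\mathbb{N}_0\cup\{-1\}$, $k\in\mathbb{Z}$; $\Lambda_0$ is the set of all of them, and $|\lambda|:=j$. With $(j,k)$ associate $I_{j,k}=2^{-j}[k,k+1)$. The children of $(j,k)$ are $(j+1,2k)$ and $(j+1,2k+1)$, and $(j,k)$ is their parent. Write $\lambda\succ\mu$ ($\lambda$ is a descendant of $\mu$, $\mu$ an ancestor of $\lambda$) if $I_\lambda\subsetneq I_\mu$, and $\lambda\succeq\mu$ if $\lambda\succ\mu$ or $\lambda=\mu$. Let $\mathcal{J}_\lambda=\{\mu\in\Lambda_0:\mu\succeq\lambda\}$. Fix a root $\mathcal{R}\in\Lambda_0$; all indices are taken in $\mathcal{J}_{\mathcal{R}}$ (in particular ''all ancestors of $\lambda$'' means all ancestors in $\mathcal{J}_{\mathcal{R}}$). A (wavelet)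 tree is a finite set $\mathcal{T}\subset\mathcal{J}_{\mathcal{R}}$ containing $\mathcal{R}$, containing with each index all its ancestors, and complete: each $\lambda\in\mathcal{T}$ has either zero or two children in $\mathcal{T}$. $\mathcal{V}(\mathcal{T})$ is the set of leaves (nodes without descendants in $\mathcal{T}$); the other nodes are inner nodes. The same notation is used for subtrees $\mathcal{J}_\lambda\cap\mathcal{T}$. For $\lambda\in\mathcal{T}$ put $r(\lambda)=r(\lambda,\mathcal{T}):=|\mathcal{V}(\mathcal{J}_\lambda\cap\mathcal{T})|-1$. **Sets $\Upsilon$.** Fix sets $\Upsilon(\lambda)$ with: (i) $\Upsilon(\lambda)=\{\mu:\lambda\succeq\mu\succeq\mu_\lambda\}$ for some fixed $\mu_\lambda\preceq\lambda$ independent of the tree; (ii) for each tree $\mathcal{T}$ and each inner node with children $\eta_1,\eta_2$, $\Upsilon(\eta_1)\cap\Upsilon(\eta_2)=\emptyset$; (iii) for each tree $\mathcal{T}$, $\bigcup_{\lambda\in\mathcal{V}(\mathcal{T})}\Upsilon(\lambda)=\mathcal{T}$. **Quarklet trees.** A quarklet index is a triple $(p,j,k)$ with $p\in\mathbb{N}_0$ and $(j,k)\in\Lambda_0$. A quarklet tree $T=(\mathcal{T},P_{\max})$ is given by a wavelet tree $\mathcal{T}$ and degrees $P_{\max}=\{p_{\max}(\lambda)\}_{\lambda\in\mathcal{V}(\mathcal{T})}\subset\mathbb{N}_0$, extended to all nodes by $p_{\max}(\mu)=p_{\max}(\lambda)$ for $\mu\in\Upsilon(\lambda)$, $\lambda\in\mathcal{V}(\mathcal{T})$;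 as a set, $T=\{(p,j,k):(j,k)\in\mathcal{T},\,0\le p\le p_{\max}(j,k)\}$. Its cardinality is $\#T=|\mathcal{T}|+\sum_{\lambda\in\mathcal{T}}p_{\max}(\lambda)$. If $\mathcal{T}\subseteq\mathcal{T}'$ are wavelet trees, $(\mathcal{T},\mathcal{T}')$ denotes the quarklet tree $(\mathcal{T},P_{\max})$ with $p_{\max}(\lambda)=r(\lambda,\mathcal{T}')$ for $\lambda\in\mathcal{V}(\mathcal{T})$. **Errors.** For given local errors, the global error of $T=(\mathcal{T},P_{\max})$ is $\mathcal{E}(T)=\sum_{\lambda\in\mathcal{V}(\mathcal{T})}e_{p_{\max}(\lambda)}(\lambda)$, and $\sigma_n=\inf\{\mathcal{E}(T):T=(\mathcal{T},P_{\max})\text{ a quarklet tree},\ \#T\le n\}$. **Algorithm NEARBEST_TREE.** Start with $\mathcal{T}'_0=\{\mathcal{R}\}$. For $N\ge1$, $\mathcal{T}'_N$ is obtained from $\mathcal{T}'_{N-1}$ by adding the two children of the leaf $s(\mathcal{R})$, where $s$ is computed for the tree $\mathcal{T}'_{N-1}$. Here, for a tree $\mathcal{T}=\mathcal{T}'_M$ of the sequence, the following are defined (any fraction of the form $\frac{ab}{a+b}$ with $a=b=0$ is set to $0$; ties in argmax are broken arbitrarily): - $e(\lambda)=e_0(\lambda)$; $\tilde e(\mathcal{R})=e(\mathcal{R})$ and $\tilde e(\lambda)=\frac{e(\lambda)\tilde e(\mu)}{e(\lambda)+\tilde e(\mu)}$ where $\mu$ is the parent of $\lambda$. - $E(\lambda)=E(\lambda,\mathcal{T})=e_0(\lambda)$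 for leaves, and $E(\lambda)=\min\{E(\eta_1)+E(\eta_2),\,e_{r(\lambda)}(\lambda)\}$ for inner nodes with children $\eta_1,\eta_2$. - $E_j(\lambda)=E(\lambda,\mathcal{T}'_k)$ for any $k$ with $\lambda\in\mathcal{T}'_k$ and $r(\lambda,\mathcal{T}'_k)=j$ (independent of the choice of $k$); $\tilde E_0(\lambda)=\tilde e(\lambda)$ and $\tilde E_j(\lambda)=\frac{E_j(\lambda)\tilde E_{j-1}(\lambda)}{E_j(\lambda)+\tilde E_{j-1}(\lambda)}$ for $j>0$. - $q(\lambda)=\tilde e(\lambda)$, $s(\lambda)=\lambda$ for leaves; for inner nodes with children $\eta_1,\eta_2$, $q(\lambda)=\min\{\max\{q(\eta_1),q(\eta_2)\},\tilde E_{r(\lambda)}(\lambda)\}$ and $s(\lambda)=s(\operatorname{argmax}\{q(\eta_1),q(\eta_2)\})$. **Trimming.** Given $\mathcal{T}'_N$, the tree $\mathcal{T}_N\subseteq\mathcal{T}'_N$ is obtained by moving from $\mathcal{R}$ towards the leaves and, at the first node $\lambda$ on each path with $E(\lambda,\mathcal{T}'_N)=e_{r(\lambda,\mathcal{T}'_N)}(\lambda)$, deleting all descendants of $\lambda$. Then $T_N=(\mathcal{T}_N,\mathcal{T}'_N)$. *)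

(* Defs.v *)
From mathcomp Require Import all_boot all_order all_algebra finmap.
From mathcomp Require Import all_classical all_reals.

Set Implicit Arguments.
Unset Strict Implicit.
Unset Printing Implicit Defensive.

Import Order.TTheory GRing.Theory Num.Theory.
Local Open Scope classical_set_scope.
Local Open Scope ring_scope.

(** * Wavelet indices *)

(* The pair (m, k) encodes the index (j, k) with j = m - 1, so that j ranges
   over {-1, 0, 1, ...}. *)
Definition windex : Type := (nat * int)%type.

Definition level (l : windex) : int := l.1%:Z - 1.

Definition dyadic (R : realType) (l : windex) : set R :=
  [set x | 2 ^ (- level l) * l.2%:~R <= x < 2 ^ (- level l) * (l.2 + 1)%:~R].

Definition child1 (l : windex) : windex := (l.1.+1, 2 * l.2).
Definition child2 (l : windex) : windex := (l.1.+1, 2 * l.2 + 1).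

(* [%/] on [int] by 2 rounds down.  The value at level -1 is junk; [parent] is
   only used strictly below the root. *)
Definition parent (l : windex) : windex := (l.1.-1, (l.2 %/ 2)%Z).

(* [desc R l m] is "l is a descendant of m". *)
Definition desc (R : realType) (l m : windex) : Prop :=
  @dyadic R l `<` @dyadic R m.
Definition desceq (R : realType) (l m : windex) : Prop :=
  desc R l m \/ l = m.

(** * Wavelet trees *)

Definition is_tree (R : realType) (root : windex) (T : {fset windex}) : Prop :=
  [/\ root \in T,
      (forall l, l \in T -> desceq R l root),
      (forall l m, l \in T -> desc R l m -> desceq R m root -> m \in T) &
      (forall l, l \in T -> (child1 l \in T) = (child2 l \in T))].

Definition leaves (R : realType) (T : {fset windex}) : {fset windex} :=
  [fset l in T | `[< forall m, m \in T -> ~ desc R m l >]]%fset.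

Definition subtree (R : realType) (l : windex) (T : {fset windex}) :
    {fset windex} :=
  [fset m in T | `[< desceq R m l >]]%fset.

Definition rank (R : realType) (l : windex) (T : {fset windex}) : nat :=
  (#|` leaves R (subtree R l T)|).-1.

(** * The sets Upsilon *)

Definition is_upsilon (R : realType) (root : windex)
    (U : windex -> set windex) : Prop :=
  [/\ (forall l, desceq R l root -> exists ml,
         [/\ desceq R l ml, desceq R ml root &
             U l = [set m | desceq R l m /\ desceq R m ml]]),
      (forall T l, is_tree R root T -> l \in T -> l \notin leaves R T ->
         U (child1 l) `&` U (child2 l) = set0) &
      (forall T, is_tree R root T ->
         \bigcup_(l in [set` leaves R T]) U l = [set` T])].

(** * Quarklet trees *)

(* Only the values of [qdeg] on the leaves of [qbase] are meaningful. *)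
Record qtree := QTree { qbase : {fset windex} ; qdeg : windex -> nat }.

Definition is_qtree (R : realType) (root : windex) (Q : qtree) : Prop :=
  is_tree R root (qbase Q).

(* Extension of the degrees to all nodes: [pmax m] is the degree of a leaf [l]
   such that [m] lies in [U l]; such a leaf exists by the third condition of
   [is_upsilon]. *)
Definition pmax (R : realType) (U : windex -> set windex) (Q : qtree)
    (m : windex) : nat :=
  qdeg Q (xget m [set l | l \in leaves R (qbase Q) /\ U l m]).

Definition qcard (R : realType) (U : windex -> set windex) (Q : qtree) : nat :=
  (#|` qbase Q| + \sum_(l <- qbase Q) pmax R U Q l)%N.

Definition qtree_of (R : realType) (T T' : {fset windex}) : qtree :=
  QTree T (fun l => rank R l T').

(** * Errors *)

Definition local_errors (R : realType) (root : windex)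
    (e : nat -> windex -> R) : Prop :=
  [/\ (forall p l, desceq R l root -> 0 <= e p l),
      (forall l, desceq R l root ->
         e 0%N (child1 l) + e 0%N (child2 l) <= e 0%N l) &
      (forall p l, desceq R l root -> e p.+1 l <= e p l)].

Definition qerror (R : realType) (e : nat -> windex -> R) (Q : qtree) : R :=
  \sum_(l <- leaves R (qbase Q)) e (qdeg Q l) l.

Definition sigma (R : realType) (root : windex) (U : windex -> set windex)
    (e : nat -> windex -> R) (n : nat) : R :=
  inf [set qerror e Q | Q in
         [set Q | is_qtree R root Q /\ (qcard R U Q <= n)%N]].

(** * NEARBEST_TREE *)

(* Division by 0 returns 0, hence [hfrac 0 0 = 0]. *)
Definition hfrac (R : realType) (a b : R) : R := a * b / (a + b).

Fixpoint etilde_rec (R : realType) (e : nat -> windex -> R) (d : nat)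
    (l : windex) : R :=
  if d is d'.+1 then hfrac (e 0%N l) (etilde_rec e d' (parent l)) else e 0%N l.

(* The recursion climbs from [l] to the root, [l.1 - root.1] levels above. *)
Definition etilde (R : realType) (root : windex) (e : nat -> windex -> R)
    (l : windex) : R :=
  etilde_rec e (l.1 - root.1)%N l.

(* The recursions over a tree [T] below ([Etree], [qval], [select]) carry
   a fuel argument, started at [#|` T|], which exceeds the height of [T]. *)
Fixpoint Etree_rec (R : realType) (e : nat -> windex -> R)
    (T : {fset windex}) (fuel : nat) (l : windex) : R :=
  if fuel is f.+1 then
    if l \in leaves R T then e 0%N l
    else Num.min (Etree_rec e T f (child1 l) + Etree_rec e T f (child2 l))
                 (e (rank R l T) l)
  else e 0%N l.

Definition Etree (R : realType) (e : nat -> windex -> R) (l : windex)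
    (T : {fset windex}) : R :=
  Etree_rec e T #|` T| l.

(* In what follows [h] lists the trees built so far, the current one first.
   [Estep e h j l] is E_j(l), evaluated in a tree T of [h] which contains [l]
   and satisfies r(l, T) = j. *)
Definition Estep (R : realType) (e : nat -> windex -> R)
    (h : seq {fset windex}) (j : nat) (l : windex) : R :=
  Etree e l
    (nth fset0 h (find (fun T => (l \in T) && (rank R l T == j)) h)).

Fixpoint Etilde (R : realType) (root : windex) (e : nat -> windex -> R)
    (h : seq {fset windex}) (j : nat) (l : windex) : R :=
  if j is j'.+1 then hfrac (Estep e h j l) (Etilde root e h j' l)
  else etilde root e l.

Fixpoint qval_rec (R : realType) (root : windex) (e : nat -> windex -> R)
    (h : seq {fset windex}) (fuel : nat) (l : windex) : R :=
  let T := head fset0 h in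
  if fuel is f.+1 then
    if l \in leaves R T then etilde root e l
    else Num.min (Num.max (qval_rec root e h f (child1 l))
                          (qval_rec root e h f (child2 l)))
                 (Etilde root e h (rank R l T) l)
  else etilde root e l.

Definition qval (R : realType) (root : windex) (e : nat -> windex -> R)
    (h : seq {fset windex}) (l : windex) : R :=
  qval_rec root e h #|` head fset0 h| l.

(* [tie l] says whether a tie between the children of [l] is resolved in favour
   of [child1 l]. *)
Fixpoint select_rec (R : realType) (root : windex) (e : nat -> windex -> R)
    (tie : windex -> bool) (h : seq {fset windex}) (fuel : nat)
    (l : windex) : windex :=
  if fuel is f.+1 then
    if l \in leaves R (head fset0 h) then l
    else
      let q1 := qval root e h (child1 l) in
      let q2 := qval root e h (child2 l) in
      if (q2 < q1) || ((q1 == q2) && tie l)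
      then select_rec root e tie h f (child1 l)
      else select_rec root e tie h f (child2 l)
  else l.

Definition select (R : realType) (root : windex) (e : nat -> windex -> R)
    (tie : windex -> bool) (h : seq {fset windex}) (l : windex) : windex :=
  select_rec root e tie h #|` head fset0 h| l.

(* [tie M] is the tie-breaking rule used on the M-th tree of the sequence. *)
Fixpoint history (R : realType) (root : windex) (e : nat -> windex -> R)
    (tie : nat -> windex -> bool) (N : nat) : seq {fset windex} :=
  if N is M.+1 then
    let h := history root e tie M in
    let s := select root e (tie M) h root in
    (head fset0 h `|` [fset child1 s; child2 s])%fset :: h
  else [:: [fset root]%fset].

Definition nearbest_tree (R : realType) (root : windex)
    (e : nat -> windex -> R) (tie : nat -> windex -> bool) (N : nat) :
    {fset windex} :=
  head fset0 (history root e tie N).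

(* The nodes deleted are those having, among their proper ancestors, a node at
   which E(m, T) = e_{r(m, T)}(m), equivalently a first such node. *)
Definition trim (R : realType) (e : nat -> windex -> R) (T : {fset windex}) :
    {fset windex} :=
  [fset l in T |
    `[< forall m, m \in T -> desc R l m ->
          Etree e m T <> e (rank R m T) m >]]%fset.

(* Main.v *)
Require Import Defs.
From mathcomp Require Import all_boot all_order all_algebra finmap.
From mathcomp Require Import all_classical all_reals.
From mathcomp Require Import ring lra zify.

(** Let t be the value of q at the root of the final tree T'_N.  Trimming
    realizes E(root, T'_N) as the global error of T_N ([trim_error]), so the
    theorem follows from the two estimates
      E(root, T'_N) <= (2 N + 1) t     and     (N - n + 1) t <= sigma_n.
    Both rest on the meaning of the modified errors: as long as everything is
    positive, 1 / etilde(l) is the sum of 1 / e_0 over l and its ancestors, and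
    1 / Etilde_j(l) adds to it the sum of 1 / E_i(l) over 1 <= i <= j.

    Lower bound on sigma_n.  The selection walks down to children with the
    larger q, and q of a node is at most the larger q of its children; hence q
    at the root is a lower bound for q along the whole walk.  Moreover q at the
    root decreases with the number of steps.  If the rank of l in T'_N is
    r + 1, look at the step that raised it from r: the walk went through l, so
    t <= q(l) <= Etilde_r(l).  The E_i(l) decrease in i and E_p <= e_p, so
    1 / Etilde_r(l) >= (r + 1 - p) / e_p(l) for p <= r.  This gives
    e_p(l) >= (rank l - p) t for all nodes l of T'_N and all p
    ([err_ge_threshold]).  Now sum over the leaves of a competing quarklet tree
    ([sum_leaves_err_ge]).  Ranks plus one count leaves of T'_N, of which there
    are N + 1 in total; a leaf of T'_N which is an inner node of the competitor
    is counted by no leaf of the competitor, but the leaves of the competitor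
    below it make up for this.  Hence the error of the competitor is at least t
    times N + 1 minus the sum of 1 + p(l) over its leaves, and the latter sum is
    at most the cardinality n ([leaf_count_le_qcard]).

    Upper bound on E(root).  From the root, follow the nodes at which q is
    realized by the children.  At a node l where this stops, Etilde_r(l) <= t
    with r = rank l, which rearranges to
      E(l) <= t (r + sum of E(l) / e_0(m) over m = l and its ancestors m).
    Sum over the f stopping nodes.  The ranks add up to N + 1 - f.  By
    subadditivity of e_0 every node m contributes at most 1 to the fractions,
    and the tree with these f leaves has 2 f - 1 nodes.  The total is N + f,
    which is at most 2 N + 1.  The induction [Etree_le_qval] performs this sum
    locally. *)

Set Implicit Arguments.
Unset Strict Implicit.
Unset Printing Implicit Defensive.

Import Order.TTheory GRing.Theory Num.Theory.
Local Open Scope classical_set_scope.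
Local Open Scope ring_scope.

(** * Dyadic intervals and the descent relation *)

(** Descent stated arithmetically, without the real intervals: [m] is the
    ancestor-or-self of [l] found by climbing the level difference. *)
Definition below (l m : windex) : bool :=
  (m.1 <= l.1)%N && (iter (l.1 - m.1) parent l == m).

Arguments below : simpl never.

Lemma iter_parent d l : iter d parent l = ((l.1 - d)%N, (l.2 %/ 2 ^+ d)%Z).
Proof.
elim: d => [|d IH]; first by rewrite subn0 expr0 divz1 -surjective_pairing.
rewrite iterS IH /parent /= subnS; congr pair.
by rewrite exprSr divzMA_ge0 // exprn_ge0.
Qed.

(** Rescaling by the width of the interval reduces all comparisons of dyadic
    intervals to comparisons of integers. *)
Lemma dyadicE (R : realType) (l : windex) (x : R) :
  @dyadic R l x = (l.2%:~R <= x * 2 ^+ l.1 / 2 < l.2%:~R + 1) :> Prop.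
Proof.
have P : (0 : R) < 2 ^+ l.1 by rewrite exprn_gt0.
rewrite /dyadic /level /=; have -> : - (l.1%:Z - 1) = 1 - l.1%:Z by lia.
rewrite expfzDr ?pnatr_eq0 // expr1z -exprnN intrD mulr1z.
congr (_ && _ : Prop); congr (_ : bool).
  by rewrite ler_pdivlMr // -mulrAC ler_pdivrMr // mulrC.
by rewrite ltr_pdivrMr // -mulrAC ltr_pdivlMr // [2 * _]mulrC.
Qed.

(** The left end point of the first interval fixes its position relative to the
    second; the midpoint is a second point of it, whose distance to the left end
    point excludes that the second interval is the shorter one. *)
Lemma dyadic_subP (R : realType) (l m : windex) :
  @dyadic R l `<=` @dyadic R m <-> below l m.
Proof.
have posX k : (0 : R) < 2 ^+ k by rewrite exprn_gt0.
have pw k : (2 : R) ^+ k = (2 ^+ k : int)%:~R by rewrite rmorphXn.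
have p1 (k : int) : k%:~R + 1 = (k + 1)%:~R :> R by rewrite intrD.
have key : (m.1 <= l.1)%N -> below l m =
    ((m.2%:~R * 2 ^+ (l.1 - m.1) : R) <= l.2%:~R) &&
    ((l.2%:~R + 1 : R) <= (m.2%:~R + 1) * 2 ^+ (l.1 - m.1)).
  move=> le; rewrite /below le iter_parent subKn // [m in _ == m]surjective_pairing.
  rewrite xpair_eqE eqxx /= pw !p1 -!intrM !ler_int.
  have p2 : (0 : int) < 2 ^+ (l.1 - m.1) by rewrite exprn_gt0.
  rewrite -lez_divRL // lezD1 -ltz_divLR // ltzD1.
  by rewrite eq_le andbC.
split=> [sub|bl x].
  (* left end point and midpoint of the interval of l *)
  pose x1 : R := l.2%:~R * 2 / 2 ^+ l.1.
  pose x2 : R := (l.2%:~R + 1 / 2) * 2 / 2 ^+ l.1.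
  have /sub : @dyadic R l x1.
    by rewrite dyadicE /x1 divfK ?gt_eqF // mulfK ?pnatr_eq0 // lexx ltrDl ltr01.
  have /sub : @dyadic R l x2.
    rewrite dyadicE /x2 divfK ?gt_eqF // mulfK ?pnatr_eq0 //; apply/andP; split; lra.
  rewrite !dyadicE => /andP[_ h2] /andP[h1 h3].
  have le : (m.1 <= l.1)%N.
    rewrite leqNgt; apply/negP => lt.
    move: h1 h2; rewrite /x1 /x2 -(subnK lt) addnS -addSn exprD.
    set D := _ ^+ _.+1; have D2 : 2 <= D.
      by rewrite /D exprS ler_peMr // exprn_ege1 // ler1n.
    have A0 := gt_eqF (posX l.1).
    have cancel y : y * 2 / 2 ^+ l.1 * (D * 2 ^+ l.1) / 2 = y * D.
      by field; rewrite A0.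
    by rewrite !cancel => h1 h2; lra.
  rewrite key //.
  move: h1 h3; rewrite /x1 -[in 2 ^+ l.1](subnK le) exprD.
  set D := _ ^+ (_ - _); have D0 : 0 < D by exact: posX.
  have M0 := gt_eqF (posX m.1).
  have -> : l.2%:~R * 2 / (D * 2 ^+ m.1) * 2 ^+ m.1 / 2 = l.2%:~R / D :> R.
    by field; rewrite M0 gt_eqF.
  rewrite ler_pdivlMr // ltr_pdivrMr // => -> /= h3.
  by move: h3; rewrite /D pw !p1 -!intrM ltr_int ler_int lezD1.
have le : (m.1 <= l.1)%N by case/andP: bl.
move: bl; rewrite key // => /andP[h1 h2].
rewrite !dyadicE -{1 2}(subnK le) exprD; move: h1 h2.
set D := 2 ^+ (_ - _); have D0 : 0 < D by exact: posX.
set y := x * 2 ^+ m.1 / 2 => h1 h2.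
have -> : x * (D * 2 ^+ m.1) / 2 = y * D by rewrite /y; ring.
move=> /andP[h3 h4]; apply/andP; split.
  by rewrite -(ler_pM2r D0); apply: le_trans h3.
by rewrite -(ltr_pM2r D0); apply: lt_le_trans h4 _.
Qed.

Lemma below_level l m : below l m -> (m.1 <= l.1)%N.
Proof. by case/andP. Qed.

Lemma below_refl l : below l l.
Proof. by rewrite /below leqnn subnn /= eqxx. Qed.

Lemma belowE l m : below l m -> iter (l.1 - m.1) parent l = m.
Proof. by case/andP => _ /eqP. Qed.

Lemma below_iter d l : (d <= l.1)%N -> below l (iter d parent l).
Proof.
by move=> le; rewrite /below iter_parent leq_subr subKn //= iter_parent eqxx.
Qed.

Lemma below_trans l m k : below m l -> below l k -> below m k.
Proof.
move=> b1 b2; have le1 := below_level b1; have le2 := below_level b2.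
rewrite /below (leq_trans le2 le1) /=.
have -> : (m.1 - k.1 = (l.1 - k.1) + (m.1 - l.1))%N by lia.
by rewrite iterD (belowE b1) (belowE b2).
Qed.

(** The ancestors of a node are linearly ordered. *)
Lemma below_chain l m k : (k.1 <= m.1)%N -> below l m -> below l k -> below m k.
Proof.
move=> le b1 b2; have le1 := below_level b1; rewrite /below le /=.
rewrite -[X in iter _ _ X](belowE b1) -iterD.
have -> : (m.1 - k.1 + (l.1 - m.1) = l.1 - k.1)%N by lia.
by rewrite (belowE b2).
Qed.

Lemma below_eq l m : below l m -> (l.1 <= m.1)%N -> l = m.
Proof.
move=> b le; have := belowE b; suff -> : (l.1 - m.1 = 0)%N by [].
by apply/eqP; rewrite subn_eq0.
Qed.

Lemma below_lt l m : below l m -> (l != m) = (m.1 < l.1)%N.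
Proof.
move=> b; case: ltnP => [lt|/(below_eq b) ->]; last by rewrite eqxx.
by apply: contraTneq lt => ->; rewrite ltnn.
Qed.

Lemma below_anti l m : below l m -> below m l -> l = m.
Proof. by move=> b1 /below_level /(below_eq b1). Qed.

Lemma parent_child1 l : parent (child1 l) = l.
Proof. by case: l => a k; rewrite /parent /= mulKz. Qed.

Lemma parent_child2 l : parent (child2 l) = l.
Proof.
case: l => a k; rewrite /parent /=; congr pair.
by rewrite divzDl ?dvdz_mulr // mulKz // divz_small ?addr0.
Qed.

Lemma children_neq l : child1 l != child2 l.
Proof.
by rewrite /child1 /child2 xpair_eqE eqxx /= -subr_eq0 opprD addrA subrr sub0r.
Qed.

Lemma below_parent c m : (0 < c.1)%N ->
  below c m = (c == m) || below (parent c) m.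
Proof.
move=> c0; apply/idP/orP => [b|[/eqP <-|b]]; last first.
- by apply: (below_trans _ b); apply: (@below_iter 1).
- exact: below_refl.
case: eqP => [|/eqP]; [by left|rewrite (below_lt b) => lt; right].
by apply: (below_chain _ (@below_iter 1 _ _)) => //=; lia.
Qed.

Lemma below_child1 l m : below (child1 l) m = (child1 l == m) || below l m.
Proof. by rewrite below_parent // parent_child1. Qed.

Lemma below_child2 l m : below (child2 l) m = (child2 l == m) || below l m.
Proof. by rewrite below_parent // parent_child2. Qed.

Lemma eq_child c l : (0 < c.1)%N -> parent c = l -> c = child1 l \/ c = child2 l.
Proof.
case: c => -[//|a] k _ <-; rewrite /child1 /child2 /parent /=.
have := divz_eq k 2; have := @modz_ge0 k 2 isT; have := @ltz_pmod k 2 isT.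
case: (k %% 2)%Z => [[|[|?]]|] // _ _ E; [left|right]; congr pair; lia.
Qed.

(** A proper descendant passes through exactly one of the two children: this is
    what makes the inductions over trees work. *)
Lemma belowP l m : 
  reflect [\/ l = m, below l (child1 m) | below l (child2 m)] (below l m).
Proof.
apply: (iffP idP) => [b|[->|b|b]].
- case: (eqVneq l m) => [|]; first by constructor 1.
  rewrite (below_lt b) => lt.
  have le : (l.1 - m.1.+1 <= l.1)%N by rewrite leq_subr.
  have := below_iter le; set c := iter _ _ _ => bc.
  have c1 : c.1 = m.1.+1 by rewrite /c iter_parent /= subKn.
  have : parent c = m.
    rewrite /c -iterS; have -> : (l.1 - m.1.+1).+1 = (l.1 - m.1)%N by lia.
    exact: belowE.
  move/eq_child; rewrite c1 => /(_ isT).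
  by case=> <-; [constructor 2|constructor 3].
- exact: below_refl.
- by apply: below_trans b _; rewrite below_child1 below_refl orbT.
- by apply: below_trans b _; rewrite below_child2 below_refl orbT.
Qed.

Lemma below_children l m : below l (child1 m) -> below l (child2 m) -> False.
Proof.
move=> b1 b2; have := children_neq m.
by rewrite -(belowE b1) -(belowE b2) /= eqxx.
Qed.

Lemma descP (R : realType) l m : desc R l m <-> below l m /\ l <> m.
Proof.
rewrite /desc properEneq; split=> [[/eqP ne /(dyadic_subP R) b]|[b ne]].
  by split=> // E; apply: ne; rewrite E.
split; last by apply/(dyadic_subP R).
apply/eqP => E; apply: ne; apply: (below_anti b).
by apply/(dyadic_subP R); rewrite E.
Qed.

Lemma desceqP (R : realType) l m : desceq R l m <-> below l m.
Proof.
split=> [[/descP[]|->]//|b]; first exact: below_refl.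
by case: (eqVneq l m) => [|/eqP ne]; [right|left; apply/descP].
Qed.

(** * Wavelet trees *)

Section Trees.
Variables (R : realType) (root : windex).
Implicit Types (T : {fset windex}) (l m : windex).
Local Notation is_tree := (is_tree R root).
Local Notation leaves := (leaves R).
Local Notation subtree := (subtree R).
Local Notation rank := (rank R).

Lemma tree_root T : is_tree T -> root \in T.
Proof. by case. Qed.

Lemma tree_below T l : is_tree T -> l \in T -> below l root.
Proof. by case=> _ h _ _ /h /(desceqP R). Qed.

Lemma tree_up T l m : is_tree T -> l \in T -> below l m -> below m root -> m \in T.
Proof.
case=> _ _ h _ lT bl br; case: (eqVneq l m) => [<- //|/eqP ne].
by apply: (h l) => //; [apply/descP|apply/desceqP].
Qed.

Lemma tree_children T l : is_tree T -> l \in T ->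
  (child2 l \in T) = (child1 l \in T).
Proof. by case=> _ _ _ h /h. Qed.

Lemma tree_intro T : root \in T -> (forall l, l \in T -> below l root) ->
  (forall l m, l \in T -> below l m -> below m root -> m \in T) ->
  (forall l, l \in T -> (child1 l \in T) = (child2 l \in T)) -> is_tree T.
Proof.
move=> h1 h2 h3 h4; split=> // [l /h2|l m lT /descP[bl _] /(desceqP R)].
  by move/(desceqP R).
exact: h3 bl.
Qed.

Lemma below_child1_root l : below l root -> below (child1 l) root.
Proof. by move=> b; rewrite below_child1 b orbT. Qed.

Lemma below_child2_root l : below l root -> below (child2 l) root.
Proof. by move=> b; rewrite below_child2 b orbT. Qed.

(** By completeness a node with a descendant in the tree has both children in
    the tree, so testing one child is enough. *)
Lemma mem_leaves T l : is_tree T ->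
  (l \in leaves T) = (l \in T) && (child1 l \notin T).
Proof.
move=> tT; rewrite !inE; case lT: (l \in T) => //=.
apply/asboolP/idP => [h|c1 m mT /descP[b ne]].
  apply/negP => /h; apply; apply/descP; split.
    by rewrite below_child1 below_refl orbT.
  by move/(congr1 fst)/eqP; rewrite /= -addn1 -[X in _ == X]addn0 eqn_add2l.
have br := tree_below tT lT.
case/belowP: b => [//|b|b]; move: c1.
  by rewrite (tree_up tT mT b) // below_child1_root.
by rewrite -(tree_children tT lT) (tree_up tT mT b) // below_child2_root.
Qed.

Lemma mem_leaves_subtree T l m : is_tree T ->
  (m \in leaves (subtree l T)) = [&& m \in T, child1 m \notin T & below m l].
Proof.
move=> tT; have E k : (k \in subtree l T) = (k \in T) && below k l.
  rewrite !inE; case: (k \in T) => //=.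
  by apply/asboolP/idP => /(desceqP R).
transitivity ((m \in leaves T) && below m l); last by rewrite mem_leaves // -andbA.
have L S k : (k \in leaves S) = (k \in S) && `[< forall m, m \in S -> ~ desc R m k >].
  by rewrite !inE.
rewrite !L E; case mT: (m \in T) => //.
case bm: (below m l); rewrite ?andbF // !andTb andbT.
apply/asboolP/asboolP=> h k kT dk.
  apply: (h k _ dk); rewrite E kT; apply: below_trans bm.
  by case/(descP R): dk.
by move: kT; rewrite E => /andP[kT _]; apply: h dk.
Qed.

Lemma leaves_subtree_root T : is_tree T -> leaves (subtree root T) = leaves T.
Proof.
move=> tT; apply/fsetP => m; rewrite mem_leaves_subtree // mem_leaves //.
case mT: (m \in T) => //=; by rewrite (tree_below tT mT) andbT.
Qed.

(** The path from the root to a node consists of distinct nodes of the tree.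
    This makes the cardinality of the tree a sufficient amount of fuel. *)
Lemma tree_depth T l : is_tree T -> l \in T -> (l.1 < root.1 + #|` T|)%N.
Proof.
move=> tT lT; have bl := tree_below tT lT; have le := below_level bl.
rewrite -ltn_subLR //.
pose s := [seq iter i parent l | i <- iota 0 (l.1 - root.1).+1].
have : {subset s <= enum_fset T}.
  move=> m /mapP[i]; rewrite mem_iota ltnS => /= ile ->.
  have bi : below l (iter i parent l) by apply: below_iter; lia.
  apply: (tree_up tT lT bi); apply: below_chain bi bl.
  by rewrite iter_parent /=; lia.
have inj (i j : nat) : (i < (l.1 - root.1).+1)%N -> (j < (l.1 - root.1).+1)%N ->
  (l.1 - i = l.1 - j)%N -> i = j by lia.
have us : uniq s.
  rewrite map_inj_in_uniq ?iota_uniq // => i j.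
  rewrite !mem_iota !iter_parent => /andP[_ hi] /andP[_ hj] /(congr1 fst) /= E.
  exact: inj hi hj E.
by move/(uniq_leq_size us); rewrite size_map size_iota.
Qed.

(** Induction from the leaves to the root, terminating by [tree_depth]. *)
Lemma tree_ind T (P : windex -> Prop) : is_tree T ->
  (forall l, l \in T -> child1 l \notin T -> P l) ->
  (forall l, l \in T -> child1 l \in T -> child2 l \in T ->
     P (child1 l) -> P (child2 l) -> P l) ->
  forall l, l \in T -> P l.
Proof.
move=> tT hleaf hinner l.
have [n] := ubnP (root.1 + #|` T| - l.1).
elim: n l => // n IH l le lT; have d := tree_depth tT lT.
case: (boolP (child1 l \in T)) => c1; last exact: hleaf.
have c2 : child2 l \in T by rewrite tree_children.
have aux (a b : nat) : (a - b < n.+1)%N -> (b < a)%N -> (a - b.+1 < n)%N by lia.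
by apply: hinner => //; apply: IH => //=; apply: aux le d.
Qed.

(** The common form of the recursions for E and q: started with fuel [#|` T|]
    they satisfy the intended fuel-free recursion at all nodes of the tree. *)
Lemma fuel_unfold (X : Type) T (G : nat -> windex -> X) (a : windex -> X)
    (op : windex -> X -> X -> X) : is_tree T ->
  (forall f l, G f.+1 l = if l \in leaves T then a l
     else op l (G f (child1 l)) (G f (child2 l))) ->
  forall l, l \in T -> G #|` T| l =
    if child1 l \in T then op l (G #|` T| (child1 l)) (G #|` T| (child2 l))
    else a l.
Proof.
move=> tT GE.
have irr (n f g : nat) l : (forall l, l \in T -> (l.1 < n)%N) -> l \in T ->
    (n <= f + l.1)%N -> (n <= g + l.1)%N -> G f l = G g l.
  move=> depth; elim: f g l => [|f IH] [|g] l lT hf hg; have d := depth _ lT;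
    try by exfalso; lia.
  rewrite !GE mem_leaves // lT /=; case: ifPn => // /negbNE c1.
  have c2 : child2 l \in T by rewrite tree_children.
  by congr op; apply: IH => //=; lia.
move=> l lT; have le := below_level (tree_below tT lT).
have -> : G #|` T| l = G #|` T|.+1 l.
  have le' : (root.1 + #|` T| <= #|` T| + l.1)%N by rewrite addnC leq_add2l.
  by apply: irr (fun l => tree_depth tT (l := l)) lT _ _; rewrite // addSn leqW.
by rewrite GE mem_leaves // lT /=; case: (child1 l \in T).
Qed.

Lemma big_leaves (V : nmodType) (F : windex -> V) T l : is_tree T -> l \in T ->
  \sum_(m <- leaves (subtree l T)) F m =
  if child1 l \in T then \sum_(m <- leaves (subtree (child1 l) T)) F m +
                         \sum_(m <- leaves (subtree (child2 l) T)) F m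
  else F l.
Proof.
move=> tT lT; have br := tree_below tT lT.
case: ifPn => c1; last first.
  suff -> : leaves (subtree l T) = [fset l]%fset by rewrite big_seq_fset1.
  apply/fsetP => m; rewrite mem_leaves_subtree // inE.
  apply/and3P/eqP => [[mT _ b]|->]; last by rewrite lT c1 below_refl.
  case/belowP: b => // b; move: c1.
    by rewrite (tree_up tT mT b) // below_child1_root.
  by rewrite -(tree_children tT lT) (tree_up tT mT b) // below_child2_root.
have sep (A : {fset windex}) (p : pred windex) m :
  (m \in [fset x in A | p x]%fset) = (m \in A) && p m by rewrite !inE.
rewrite (big_fsetID _ (fun m => below m (child1 l))) /=; congr (_ + _).
  congr (\sum_(m <- _) _); congr (enum_fset _).
  apply/fsetP => m; rewrite sep !mem_leaves_subtree //.
  case: (m \in T) => //=; case: (_ \in T) => //=.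
  apply/andP/idP => [[]//|b]; split => //.
  by apply: (below_trans b); rewrite below_child1 below_refl orbT.
congr (\sum_(m <- _) _); congr (enum_fset _).
apply/fsetP => m; rewrite sep !mem_leaves_subtree //.
case mT: (m \in T) => //=; case cT: (_ \in T) => //=.
apply/andP/idP => [[/belowP[E|-> //|//]]|b].
  by move: cT; rewrite E c1.
split; last by apply/negP => /below_children /(_ b).
by apply: (below_trans b); rewrite below_child2 below_refl orbT.
Qed.

Lemma card_leaves T l : is_tree T -> l \in T -> #|` leaves (subtree l T)| = (rank l T).+1.
Proof.
move=> tT lT; rewrite prednK //.
move: l lT; apply: (tree_ind tT) => [l lT c1|l lT c1 c2 h1 h2];
  rewrite -sum1_size (big_leaves _ tT lT).
  by rewrite (negbTE c1).
by rewrite c1 !sum1_size addn_gt0 h1.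
Qed.

Lemma rank_unfold T l : is_tree T -> l \in T -> rank l T =
  if child1 l \in T then (rank (child1 l) T + rank (child2 l) T).+1 else 0%N.
Proof.
move=> tT lT; apply: succn_inj; rewrite -card_leaves //.
rewrite -sum1_size (big_leaves _ tT lT); case: ifPn => // c1.
have c2 : child2 l \in T by rewrite tree_children.
by rewrite !sum1_size !card_leaves //; exact: (congr1 S (addnS _ _)).
Qed.

Lemma rank_mono T T' l : is_tree T -> is_tree T' -> (T `<=` T')%fset -> l \in T ->
  (rank l T <= rank l T')%N.
Proof.
move=> tT tT' /fsubsetP sub; move: l.
apply: (tree_ind tT) => [l lT c1|l lT c1 c2 h1 h2].
  by rewrite rank_unfold // (negbTE c1).
rewrite (rank_unfold tT) // (rank_unfold tT') ?sub // c1 ltnS.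
exact: leq_add.
Qed.

End Trees.

(** * Harmonic fractions *)

Section HarmonicFraction.
Variable R : realType.
Implicit Types a b c : R.

Lemma hfrac_ge0 a b : 0 <= a -> 0 <= b -> 0 <= hfrac a b.
Proof. by move=> a0 b0; rewrite /hfrac divr_ge0 ?mulr_ge0 ?addr_ge0. Qed.

(** In terms of inverses: if [1/a >= 1/c] and [1/b >= k/c], then
    [1/a + 1/b >= (k+1)/c].  This form remains true when some of the numbers
    vanish. *)
Lemma hfrac_le_scaled a b c (k : nat) : 0 <= a -> 0 <= b ->
  a <= c -> k%:R * b <= c -> k.+1%:R * hfrac a b <= c.
Proof.
move=> a0 b0 ac bc; have c0 := le_trans a0 ac.
have := addr_ge0 a0 b0; rewrite le_eqVlt => /predU1P[ab|ab].
  by rewrite /hfrac -ab invr0 !mulr0.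
rewrite /hfrac mulrA ler_pdivrMr // -natr1.
have : 0 <= (c - k%:R * b) * a by rewrite mulr_ge0 ?subr_ge0.
have : 0 <= (c - a) * b by rewrite mulr_ge0 ?subr_ge0.
by lra.
Qed.

Lemma hfrac_ler a b : 0 <= a -> 0 <= b -> hfrac a b <= b.
Proof.
move=> a0 b0; have := addr_ge0 a0 b0; rewrite le_eqVlt => /predU1P[ab|ab].
  by rewrite /hfrac -ab invr0 mulr0.
by rewrite /hfrac ler_pdivrMr // mulrC ler_wpM2l // lerDl.
Qed.

Lemma hfrac_gt0 a b : 0 < a -> 0 < b -> 0 < hfrac a b.
Proof. by move=> a0 b0; rewrite /hfrac divr_gt0 ?mulr_gt0 ?addr_gt0. Qed.

Lemma hfracV a b : 0 < a -> 0 < b -> (hfrac a b)^-1 = a^-1 + b^-1.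
Proof.
move=> a0 b0; rewrite /hfrac; field.
by rewrite !gt_eqF // addr_gt0.
Qed.

End HarmonicFraction.

(** * Errors on a tree *)

Section TreeErrors.
Variables (R : realType) (root : windex) (e : nat -> windex -> R).
Hypothesis he : local_errors root e.
Implicit Types (T : {fset windex}) (l m : windex).
Local Notation is_tree := (is_tree R root).
Local Notation rank := (rank R).

Lemma err_ge0 p l : below l root -> 0 <= e p l.
Proof. by case: he => h _ _ /(desceqP R); exact: h. Qed.

Lemma err_le p q l : below l root -> (p <= q)%N -> e q l <= e p l.
Proof.
move=> b; elim: q => [|q IH]; first by rewrite leqn0 => /eqP ->.
rewrite leq_eqVlt => /predU1P[->//|/IH]; apply: le_trans.
by case: he => _ _; apply; apply/desceqP.
Qed.

Lemma err_children l : below l root -> e 0%N (child1 l) + e 0%N (child2 l) <= e 0%N l.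
Proof. by move=> b; case: he => _ h _; apply/h/desceqP. Qed.

Lemma Etree_unfold T l : is_tree T -> l \in T -> Etree e l T =
  if child1 l \in T then
    Num.min (Etree e (child1 l) T + Etree e (child2 l) T) (e (rank l T) l)
  else e 0%N l.
Proof.
move=> tT lT; exact: (@fuel_unfold R root R T (Etree_rec e T) (e 0%N)
  (fun l x y => Num.min (x + y) (e (rank l T) l)) tT (fun _ _ => erefl)).
Qed.

Lemma Etree_ge0 T l : is_tree T -> l \in T -> 0 <= Etree e l T.
Proof.
move=> tT; move: l; apply: (tree_ind tT) => [l lT c1|l lT c1 c2 h1 h2];
  have b := tree_below tT lT; rewrite Etree_unfold //.
  by rewrite (negbTE c1) err_ge0.
by rewrite c1 le_min addr_ge0 // err_ge0.
Qed.

Lemma Etree_le_err T l : is_tree T -> l \in T -> Etree e l T <= e (rank l T) l.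
Proof.
move=> tT lT; rewrite Etree_unfold //; case: ifPn => c1.
  by rewrite ge_min lexx orbT.
by rewrite (rank_unfold tT lT) (negbTE c1).
Qed.

Lemma Etree_le_err0 T l : is_tree T -> l \in T -> Etree e l T <= e 0%N l.
Proof.
by move=> tT lT; apply: le_trans (Etree_le_err tT lT) (err_le (tree_below tT lT) _).
Qed.

(** A larger tree offers more subdivisions, and larger degrees at the nodes. *)
Lemma Etree_mono T T' l : is_tree T -> is_tree T' -> (T `<=` T')%fset -> l \in T ->
  Etree e l T' <= Etree e l T.
Proof.
move=> tT tT' sub; have /fsubsetP ss := sub; move: l.
apply: (tree_ind tT) => [l lT c1|l lT c1 c2 h1 h2].
  by rewrite (Etree_unfold tT) // (negbTE c1) Etree_le_err0 // ss.
rewrite (Etree_unfold tT lT) (Etree_unfold tT' (ss _ lT)) (ss _ c1) c1.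
rewrite le_min !ge_min lerD //=; apply/orP; right.
by apply: err_le; [exact: tree_below tT lT|exact: (@rank_mono _ root)].
Qed.

(** Nested trees with the same rank at [l] coincide below [l], so E_j(l) does
    not depend on the tree used to evaluate it. *)
Lemma Etree_eq_rank T T' l : is_tree T -> is_tree T' -> (T `<=` T')%fset -> l \in T ->
  rank l T = rank l T' -> Etree e l T = Etree e l T'.
Proof.
move=> tT tT' sub; have /fsubsetP ss := sub; move: l.
apply: (tree_ind tT) => [l lT c1|l lT c1 c2 h1 h2] E; have E' := E; move: E.
  rewrite (rank_unfold tT lT) (rank_unfold tT' (ss _ lT)) (negbTE c1).
  case: ifPn => // c1' _.
  by rewrite (Etree_unfold tT lT) (Etree_unfold tT' (ss _ lT)) (negbTE c1) (negbTE c1').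
rewrite (rank_unfold tT lT) (rank_unfold tT' (ss _ lT)) (ss _ c1) c1 => -[E].
have r1 := rank_mono tT tT' sub c1; have r2 := rank_mono tT tT' sub c2.
rewrite (Etree_unfold tT lT) (Etree_unfold tT' (ss _ lT)) (ss _ c1) c1 E'.
by rewrite h1 ?h2 //; apply/eqP; rewrite eqn_leq ?r1 ?r2 /=; lia.
Qed.

(** * Trimming *)

Lemma mem_trim T l : (l \in trim e T) = (l \in T) &&
  `[< forall m, m \in T -> below l m -> l != m -> Etree e m T != e (rank m T) m >].
Proof.
rewrite !inE; case: (l \in T) => //=.
apply/asboolP/asboolP => h m mT => [b|/descP[b]] /eqP.
  by move=> ne; apply/eqP; apply: h => //; apply/descP.
by move=> ne; apply/eqP; apply: h.
Qed.

Lemma trim_parent T c l : is_tree T -> l \in T -> c \in T -> (0 < c.1)%N ->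
  parent c = l ->
  (c \in trim e T) = (l \in trim e T) && (Etree e l T != e (rank l T) l).
Proof.
move=> tT lT cT c0 pc; rewrite !mem_trim lT cT !andTb.
have bcl : below c l by rewrite below_parent // pc below_refl orbT.
have ncl : c != l.
  by rewrite (below_lt bcl) -pc /parent /= prednK.
apply/asboolP/andP => [h|[/asboolP h1 h2] m mT].
  split; last exact: h.
  apply/asboolP => m mT b ne; apply: h => //; first exact: below_trans b.
  apply/eqP => E; move/eqP: ne; apply.
  by apply: below_anti b _; rewrite -E.
rewrite below_parent // pc => /predU1P[->|b _]; first by rewrite eqxx.
by case: (eqVneq l m) => [<-//|]; apply: h1.
Qed.

Lemma trim_is_tree T : is_tree T -> is_tree (trim e T).
Proof.
move=> tT; have rT := tree_root tT.
have sub l : l \in trim e T -> l \in T by rewrite mem_trim => /andP[].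
apply: tree_intro => [|l /sub/(tree_below tT)//|l m|l lt].
- rewrite mem_trim rT /=; apply/asboolP => m /(tree_below tT) b b'.
  by rewrite (below_anti b b') eqxx.
- rewrite !mem_trim => /andP[lT /asboolP h] b br.
  rewrite (tree_up tT lT b br) /=; apply/asboolP => k kT bk ne.
  apply: h => //; first exact: below_trans bk.
  apply/eqP => E; move/eqP: ne; apply; apply: below_anti bk _.
  by rewrite -E.
have lT := sub _ lt; case: (boolP (child1 l \in T)) => c1.
  have c2 : child2 l \in T by rewrite (tree_children tT).
  rewrite (trim_parent tT lT c1 isT (parent_child1 l)).
  by rewrite (trim_parent tT lT c2 isT (parent_child2 l)).
rewrite !mem_trim (tree_children tT) //.
by rewrite (negbTE c1).
Qed.

(** Above the trimming nodes the minimum in the recursion for E is attained by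
    the sum over the children; at them it is the error of the highest degree. *)
Lemma trim_error T : is_tree T -> qerror e (qtree_of R (trim e T) T) = Etree e root T.
Proof.
move=> tT; rewrite /qerror /=.
have tt := trim_is_tree tT; rewrite -(leaves_subtree_root tt).
have := tree_root tt; move: (root) (tree_root tT).
apply: (tree_ind tT) => [l lT c1|l lT c1 c2 h1 h2] lt;
   rewrite (big_leaves _ tt lt) (Etree_unfold tT lT).
  have rk : rank l T = 0%N by rewrite (rank_unfold tT lT) (negbTE c1).
  by rewrite mem_trim !(negbTE c1) rk.
have pc1 := @trim_parent T (child1 l) l tT lT c1 isT (parent_child1 l).
have pc2 := @trim_parent T (child2 l) l tT lT c2 isT (parent_child2 l).
rewrite lt /= in pc1 pc2.
rewrite c1 pc1; case: ifPn => [ne|]; last first.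
  by rewrite negbK Etree_unfold // c1 => /eqP ->.
rewrite h1 ?h2 ?pc1 ?pc2 //.
move: ne; rewrite Etree_unfold // c1.
by case: leP => //; rewrite eqxx.
Qed.

(** * Subdividing a leaf *)

Definition grow T l : {fset windex} := (T `|` [fset child1 l; child2 l])%fset.

Lemma mem_grow T s l : (l \in grow T s) = [|| l \in T, l == child1 s | l == child2 s].
Proof. by rewrite !inE. Qed.

Lemma sub_grow T s : (T `<=` grow T s)%fset.
Proof. exact: fsubsetUl. Qed.

Lemma child1_inj l m : (child1 l == child1 m) = (l == m).
Proof.
by apply/eqP/eqP => [E|->//]; rewrite -(parent_child1 l) E parent_child1.
Qed.

Lemma child1_neq2 l m : (child1 l == child2 m) = false.
Proof.
apply/eqP => E; have := children_neq m.
by rewrite -E -(parent_child2 m) -E parent_child1 eqxx.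
Qed.

Lemma child1_grow T s l : (child1 l \in grow T s) = (child1 l \in T) || (l == s).
Proof. by rewrite mem_grow child1_inj child1_neq2 orbF. Qed.

Lemma grow_is_tree T s : is_tree T -> s \in T -> is_tree (grow T s).
Proof.
move=> tT sT; have bs := tree_below tT sT.
apply: tree_intro => [|l|l m|l]; rewrite ?mem_grow.
- by rewrite (tree_root tT).
- case/or3P => [/(tree_below tT)//|/eqP->|/eqP->].
    exact: below_child1_root.
  exact: below_child2_root.
- case/or3P => [lT b br|/eqP->|/eqP->].
  + by rewrite (tree_up tT lT b br).
  + rewrite below_child1 => /predU1P[<-|b br]; first by rewrite eqxx orbT.
    by rewrite (tree_up tT sT b br).
  + rewrite below_child2 => /predU1P[<-|b br]; first by rewrite eqxx !orbT.
    by rewrite (tree_up tT sT b br).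
move=> lT; rewrite !child1_inj child1_neq2 orbF [child2 l == _]eq_sym child1_neq2 /=.
have -> : (child2 l == child2 s) = (l == s).
  by apply/eqP/eqP => [E|->//]; rewrite -(parent_child2 l) E parent_child2.
case: (boolP (l \in T)) lT => [lT _|nl /= lc]; first by rewrite (tree_children tT).
have bl : below l root.
  by case/orP: lc => /eqP ->; [exact: below_child1_root|exact: below_child2_root].
have n1 : (child1 l \in T) = false.
  apply: contraNF nl => c; apply: (tree_up tT c) => //.
  by rewrite below_child1 below_refl orbT.
have n2 : (child2 l \in T) = false.
  apply: contraNF nl => c; apply: (tree_up tT c) => //.
  by rewrite below_child2 below_refl orbT.
by rewrite n1 n2.
Qed.

(** The leaf [s] is replaced by its two children, which are leaves below the same
    nodes of the tree as [s]. *)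
Lemma rank_grow T s l : is_tree T -> s \in T -> child1 s \notin T -> l \in T ->
  rank l (grow T s) = (rank l T + below s l)%N.
Proof.
move=> tT sT sl; have tG := grow_is_tree tT sT.
have rk0 c : (c = child1 s) \/ (c = child2 s) -> rank c (grow T s) = 0%N.
  move=> hc; have cG : c \in grow T s.
    by rewrite mem_grow; case: hc => ->; rewrite eqxx ?orbT.
  rewrite (rank_unfold tG cG); case: ifP => // cc; exfalso.
  move: cc; rewrite child1_grow => /orP[cT|/eqP E].
    have bc : below (child1 c) (child1 s) \/ below (child1 c) (child2 s).
      by case: hc => <-; [left|right]; rewrite below_child1 below_refl orbT.
    case: bc => bc; move: sl; last rewrite -(tree_children tT sT).
      by rewrite (tree_up tT cT bc) // below_child1_root // (tree_below tT).
    by rewrite (tree_up tT cT bc) // below_child2_root // (tree_below tT).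
  case: hc; rewrite E => /(congr1 fst) /= /eqP;
    by rewrite -addn1 -[X in X == _]addn0 eqn_add2l.
move: l; apply: (tree_ind tT) => [l lT c1|l lT c1 c2 h1 h2];
  have lG : l \in grow T s by rewrite mem_grow lT.
  rewrite (rank_unfold tG lG) (rank_unfold tT lT) child1_grow (negbTE c1) /=.
  case: eqVneq => [->|ne]; first by rewrite below_refl rk0; [rewrite rk0; auto|left].
  case b: (below s l) => //; exfalso; have bl := tree_below tT lT.
  case/belowP: b => [E|b|b]; first by rewrite E eqxx in ne.
    by move: c1; rewrite (tree_up tT sT b) // below_child1_root.
  by move: c1; rewrite -(tree_children tT lT) (tree_up tT sT b) // below_child2_root.
rewrite (rank_unfold tG lG) (rank_unfold tT lT) child1_grow c1 /= h1 h2.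
have -> : nat_of_bool (below s l) = (below s (child1 l) + below s (child2 l))%N.
  case b1: (below s (child1 l)); case b2: (below s (child2 l)).
  - by case: (below_children b1 b2).
  - by have /belowP -> : [\/ s = l, below s (child1 l) | below s (child2 l)];
      first constructor 2.
  - by have /belowP -> : [\/ s = l, below s (child1 l) | below s (child2 l)];
      first constructor 3.
  case b: (below s l) => //; case/belowP: b; rewrite ?b1 ?b2 // => E.
  by rewrite E c1 in sl.
by rewrite addnACA addSn.
Qed.

Lemma rank_grow_new T s l : is_tree T -> s \in T -> child1 s \notin T ->
  l \in grow T s -> l \notin T -> rank l (grow T s) = 0%N.
Proof.
move=> tT sT sl lG lT; have tG := grow_is_tree tT sT.
rewrite (rank_unfold tG lG); case: ifP => // cc; exfalso.
move: cc; rewrite child1_grow => /orP[cT|/eqP E]; last by rewrite E sT in lT.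
move: lT; rewrite (tree_up tT cT) ?(tree_below tG) //.
by rewrite below_child1 below_refl orbT.
Qed.

Lemma singleton_is_tree : is_tree [fset root]%fset.
Proof.
apply: tree_intro => [|l|l m|l]; rewrite !inE //.
- by move/eqP ->; exact: below_refl.
- by move/eqP -> => b b'; rewrite (below_anti b b').
move/eqP ->; rewrite /child1 /child2.
have ne k : ((root.1.+1, k) == root) = false.
  by apply/eqP => /(congr1 fst) /= /eqP; rewrite -addn1 -[X in _ == X]addn0 eqn_add2l.
by rewrite !ne.
Qed.

End TreeErrors.

(** * The greedy sequence of trees *)

Section Greedy.
Variables (R : realType) (root : windex) (e : nat -> windex -> R).
Variable tie : nat -> windex -> bool.
Hypothesis he : local_errors root e.
Implicit Types (T : {fset windex}) (l m : windex) (h : seq {fset windex}).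
Local Notation is_tree := (is_tree R root).
Local Notation rank := (rank R).
Local Notation etilde := (etilde root e).
Local Notation hist := (history root e tie).
Local Notation tree := (nearbest_tree root e tie).
Local Notation sel k := (select root e (tie k) (hist k) root).

Lemma etilde_below c l : below l root -> (0 < c.1)%N -> parent c = l ->
  etilde c = hfrac (e 0%N c) (etilde l).
Proof.
move=> b c0 pc; rewrite /Defs.etilde; have := below_level b.
by rewrite -{1}pc /= => le; rewrite -(prednK c0) subSn //= pc -[c.1.-1]/(parent c).1 pc.
Qed.

Lemma etilde_root : etilde root = e 0%N root.
Proof. by rewrite /Defs.etilde subnn. Qed.

Lemma below_ind (P : windex -> Prop) : P root ->
  (forall c l, below l root -> below c root -> (0 < c.1)%N -> parent c = l -> P l -> P c) ->
  forall l, below l root -> P l.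
Proof.
move=> P0 Pc l b; have [n] := ubnP (l.1 - root.1).
elim: n l b => // n IH l b le; case: (eqVneq l root) => [->//|].
rewrite (below_lt b) => lt; have l0 : (0 < l.1)%N by lia.
have pb : below (parent l) root.
  by move: b lt; rewrite below_parent // => /orP[/eqP ->|//]; rewrite ltnn.
apply: (Pc l (parent l)) => //; apply: IH => //=; lia.
Qed.

Lemma etilde_bounds l : below l root -> 0 <= etilde l <= e 0%N l.
Proof.
move: l; apply: below_ind => [|c l b b' c0 pc /andP[h1 h2]].
  by rewrite etilde_root lexx (err_ge0 he) // below_refl.
have ec := err_ge0 he 0 b'.
rewrite (etilde_below b c0 pc) hfrac_ge0 //=.
have := @hfrac_le_scaled _ (e 0%N c) (etilde l) (e 0%N c) 0 ec h1.
by rewrite mul0r mul1r; apply.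
Qed.

Lemma etilde_ge0 l : below l root -> 0 <= etilde l.
Proof. by case/etilde_bounds/andP. Qed.

Lemma qval_unfold h l : let T := head fset0 h in is_tree T -> l \in T ->
  qval root e h l = if child1 l \in T then
    Num.min (Num.max (qval root e h (child1 l)) (qval root e h (child2 l)))
            (Etilde root e h (rank l T) l)
  else etilde l.
Proof.
move=> T tT lT; exact: (@fuel_unfold R root R T (qval_rec root e h) etilde
  (fun l x y => Num.min (Num.max x y) (Etilde root e h (rank l T) l)) tT
  (fun _ _ => erefl)).
Qed.

Lemma qval_le_Etilde h l : let T := head fset0 h in is_tree T -> l \in T ->
  qval root e h l <= Etilde root e h (rank l T) l.
Proof.
move=> T tT lT; rewrite qval_unfold //; case: ifPn => c1.
  by rewrite ge_min lexx orbT.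
by rewrite (rank_unfold tT lT) (negbTE c1).
Qed.

(** The walk goes to the child with the larger q, and q of an inner node is at
    most that value.  So q at the root is the smallest one along the walk. *)
Lemma selectP ti h : let T := head fset0 h in let s := select root e ti h root in
  is_tree T -> [/\ s \in T, child1 s \notin T &
    forall m, below s m -> below m root -> qval root e h root <= qval root e h m].
Proof.
move=> T s tT.
(* n bounds the levels occurring in the tree, so that the fuel suffices *)
have gen n f l : (forall l, l \in T -> (l.1 < n)%N) -> l \in T -> (n <= f + l.1)%N ->
    let s := select_rec root e ti h f l in
    [/\ s \in T, child1 s \notin T, below s l &
      forall m, below s m -> below m l -> qval root e h l <= qval root e h m].
  move=> depth; elim: f l => [|f IH] l lT le.
    by have := depth _ lT; rewrite ltnNge le.
  rewrite /= (mem_leaves _ tT) lT /=; case: ifPn => [c1|/negbNE c1].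
    split=> //; first exact: below_refl.
    by move=> m b b'; rewrite (below_anti b b').
  have c2 : child2 l \in T by rewrite (tree_children tT).
  have le' : (n <= f + l.1.+1)%N by rewrite addnS -addSn.
  have qM := qval_unfold tT lT; rewrite -/T c1 in qM.
  have q1 := IH _ c1 le'; have q2 := IH _ c2 le'; case: ifPn => [q|q].
    have {q} q : qval root e h (child2 l) <= qval root e h (child1 l).
      by case/orP: q => [/ltW//|/andP[/eqP->]].
    case: q1; set s1 := select_rec _ _ _ _ _ _ => s1T s1l s1b s1q; split=> //.
      by apply: below_trans s1b _; rewrite below_child1 below_refl orbT.
    have ql : qval root e h l <= qval root e h (child1 l).
      by rewrite qM (max_idPl q) ge_min lexx.
    move=> m bm /belowP[->//|b|b]; first exact: le_trans ql (s1q _ bm b).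
    by case: (below_children s1b (below_trans bm b)).
  have {q} q : qval root e h (child1 l) <= qval root e h (child2 l).
    by rewrite negb_or -leNgt in q; case/andP: q.
  case: q2; set s1 := select_rec _ _ _ _ _ _ => s1T s1l s1b s1q; split=> //.
    by apply: below_trans s1b _; rewrite below_child2 below_refl orbT.
  have ql : qval root e h l <= qval root e h (child2 l).
    by rewrite qM (max_idPr q) ge_min lexx.
  move=> m bm /belowP[->//|b|b]; last exact: le_trans ql (s1q _ bm b).
  by case: (below_children (below_trans bm b) s1b).
have le : (root.1 + #|` T| <= #|` T| + root.1)%N by rewrite addnC.
by case: (gen _ _ _ (fun l => tree_depth tT (l := l)) (tree_root tT) le).
Qed.

Lemma treeS k : tree k.+1 = grow (tree k) (sel k).
Proof. by []. Qed.

Lemma tree_is_tree k : is_tree (tree k).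
Proof.
elim: k => [|k IH]; first exact: singleton_is_tree.
by rewrite treeS; apply: grow_is_tree => //; case: (selectP (tie k) IH).
Qed.
Hint Resolve tree_is_tree : core.

Lemma tree_selectP k : [/\ sel k \in tree k, child1 (sel k) \notin tree k &
  forall m, below (sel k) m -> below m root ->
    qval root e (hist k) root <= qval root e (hist k) m].
Proof. exact: selectP (tree_is_tree k). Qed.

Lemma tree_sub i j : (i <= j)%N -> (tree i `<=` tree j)%fset.
Proof.
elim: j => [|j IH]; first by rewrite leqn0 => /eqP ->.
rewrite leq_eqVlt => /predU1P[->//|/IH s]; apply: (fsubset_trans s).
by rewrite treeS; exact: sub_grow.
Qed.

Lemma tree_memW i j l : (i <= j)%N -> l \in tree i -> l \in tree j.
Proof. by move/tree_sub/fsubsetP; apply. Qed.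

Lemma rank_treeS k l : l \in tree k ->
  rank l (tree k.+1) = (rank l (tree k) + below (sel k) l)%N.
Proof.
move=> lT; rewrite treeS; case: (tree_selectP k) => sT sl _.
exact: (rank_grow (tree_is_tree k)).
Qed.

Lemma rank_tree_new k l : l \in tree k.+1 -> l \notin tree k -> rank l (tree k.+1) = 0%N.
Proof.
rewrite treeS; case: (tree_selectP k) => sT sl _.
exact: (rank_grow_new (tree_is_tree k)).
Qed.

Lemma rank_tree_root k : rank root (tree k) = k.
Proof.
elim: k => [|k IH].
  rewrite (rank_unfold (tree_is_tree 0) (tree_root (tree_is_tree 0))) ifN //.
  rewrite inE; apply/eqP => /(congr1 fst) /= /eqP.
  by rewrite -addn1 -[X in _ == X]addn0 eqn_add2l.
have tk := tree_is_tree k; rewrite (rank_treeS (tree_root tk)) IH.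
by case: (tree_selectP k) => sT _ _; rewrite (tree_below tk sT) addn1.
Qed.

(** Ranks grow by at most one per step and new nodes have rank 0, so each
    positive rank has been reached by a step whose walk went through [l]. *)
Lemma rank_increment N l r : l \in tree N -> rank l (tree N) = r.+1 ->
  exists k, [/\ (k < N)%N, l \in tree k, rank l (tree k) = r & below (sel k) l].
Proof.
elim: N => [|N IH] lT E.
  have := tree_below (tree_is_tree 0) lT => b.
  have El : l = root by apply/eqP; move: lT; rewrite inE.
  by move: E; rewrite El rank_tree_root.
case: (boolP (l \in tree N)) => lN; last by rewrite rank_tree_new in E.
move: E; rewrite rank_treeS //; case b: (below (sel N) l) => E.
  by exists N; split=> //; move: E; rewrite addn1 => -[].
have [|k [lt k1 k2 k3]] := IH lN; first by rewrite -E addn0.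
by exists k; split=> //; apply: ltnW.
Qed.

Lemma rank_reached N l j : l \in tree N -> (j <= rank l (tree N))%N ->
  exists k, [/\ (k <= N)%N, l \in tree k & rank l (tree k) = j].
Proof.
have [n] := ubnP N; elim: n N => // n IH N lt lT.
rewrite leq_eqVlt => /predU1P[->|]; first by exists N.
case E: (rank l (tree N)) => [//|r]; rewrite ltnS => jr.
have [k [kN lk rk _]] := rank_increment lT E.
have [||k' [h1 h2 h3]] := IH k _ lk; [lia|by rewrite rk|].
by exists k'; split=> //; lia.
Qed.

(** The search in the history may hit another tree than the given one, but
    the two trees are nested and have the same rank at [l]. *)
Lemma Estep_hist M k l j : (k <= M)%N -> l \in tree k -> rank l (tree k) = j ->
  Estep e (hist M) j l = Etree e l (tree k).
Proof.
move=> kM lk rk; elim: M kM => [|M IH] kM.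
  have /eqP k0 : k == 0%N by rewrite -leqn0.
  by move: lk rk; rewrite k0 /Estep /= => -> ->; rewrite eqxx.
have hS : hist M.+1 = tree M.+1 :: hist M by [].
have lM : l \in tree M.+1 by exact: tree_memW lk.
rewrite /Estep hS /= lM /=; case: eqP => [E|NE] /=.
  apply/esym/(Etree_eq_rank e (tree_is_tree k) (tree_is_tree M.+1)) => //.
    exact: tree_sub.
  by rewrite rk E.
apply: IH; move: kM; rewrite leq_eqVlt => /predU1P[E|//].
by case: NE; rewrite -E.
Qed.

Lemma Estep_ge0 M l j : l \in tree M -> (j <= rank l (tree M))%N ->
  0 <= Estep e (hist M) j l.
Proof.
move=> lM /(rank_reached lM)[k [kM lk rk]].
by rewrite (Estep_hist kM lk rk) (Etree_ge0 he (tree_is_tree k)).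
Qed.

Lemma Estep_le_err M l j : l \in tree M -> (j <= rank l (tree M))%N ->
  Estep e (hist M) j l <= e j l.
Proof.
move=> lM /(rank_reached lM)[k [kM lk rk]].
by rewrite (Estep_hist kM lk rk) -rk (Etree_le_err e (tree_is_tree k)).
Qed.

Lemma Estep_le M l i j : l \in tree M -> (i <= j)%N -> (j <= rank l (tree M))%N ->
  Estep e (hist M) j l <= Estep e (hist M) i l.
Proof.
move=> lM ij /(rank_reached lM)[k [kM lk rk]].
have [|k' [kM' lk' rk']] := @rank_reached k l i lk; first by rewrite rk.
rewrite (Estep_hist kM lk rk) (Estep_hist (leq_trans kM' kM) lk' rk').
by apply: (Etree_mono he (tree_is_tree k') (tree_is_tree k)) => //; apply: tree_sub.
Qed.

Lemma Etilde_ge0 M l j : l \in tree M -> (j <= rank l (tree M))%N ->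
  0 <= Etilde root e (hist M) j l.
Proof.
move=> lM; elim: j => [|j IH] le /=.
  by apply: etilde_ge0; exact: tree_below (tree_is_tree M) lM.
by apply: hfrac_ge0; [exact: Estep_ge0|apply: IH; exact: ltnW].
Qed.

Lemma Etilde_le M l i j : l \in tree M -> (i <= j)%N -> (j <= rank l (tree M))%N ->
  Etilde root e (hist M) j l <= Etilde root e (hist M) i l.
Proof.
move=> lM; elim: j => [|j IH]; first by rewrite leqn0 => /eqP ->.
rewrite leq_eqVlt => /predU1P[->//|ij] jr; apply: le_trans (IH ij (ltnW jr)) => /=.
by apply: hfrac_ler; [exact: Estep_ge0|apply: Etilde_ge0 => //; exact: ltnW].
Qed.

Lemma Etilde_hist M N l j : (M <= N)%N -> l \in tree M -> (j <= rank l (tree M))%N ->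
  Etilde root e (hist M) j l = Etilde root e (hist N) j l.
Proof.
move=> MN lM; elim: j => [//|j IH] le /=; rewrite (IH (ltnW le)).
have [k [kM lk rk]] := rank_reached lM le.
by rewrite (Estep_hist kM lk rk) (Estep_hist (leq_trans kM MN) lk rk).
Qed.

(** In terms of inverses: 1/Etilde_(p+d)(l) contains the summands 1/E_i(l) for
    p <= i <= p + d, each of them at least 1/e_p(l); for p = 0 the first one
    is 1/etilde(l). *)
Lemma Etilde_mul_le M l p d : l \in tree M -> (p + d <= rank l (tree M))%N ->
  d.+1%:R * Etilde root e (hist M) (p + d) l <= e p l.
Proof.
move=> lM; have b := tree_below (tree_is_tree M) lM.
elim: d => [|d IH] le.
  move: le; rewrite addn0 mul1r; case: p => [|p] le /=.
    by case/andP: (etilde_bounds b).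
  have E0 := Estep_ge0 lM le; have F0 := Etilde_ge0 lM (ltnW le).
  have := @hfrac_le_scaled _ _ _ (e p.+1 l) 0 E0 F0 (Estep_le_err lM le).
  by rewrite mul0r mul1r; apply; exact: (err_ge0 he _ b).
move: le; rewrite addnS => le /=.
have F0 := Etilde_ge0 lM (ltnW le); have pr : (p <= (p + d).+1)%N by lia.
apply: hfrac_le_scaled => //; [exact: Estep_ge0| |exact: IH (ltnW le)].
exact: le_trans (Estep_le lM pr le) (Estep_le_err lM (leq_trans pr le)).
Qed.

(** At a leaf that is subdivided, q passes from [Etilde] of index 0 to at most
    [Etilde] of index 1; elsewhere both terms of the minimum decrease. *)
Lemma qval_antimono k l : l \in tree k ->
  qval root e (hist k.+1) l <= qval root e (hist k) l.
Proof.
have tk := tree_is_tree k; have tS := tree_is_tree k.+1.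
have ss := @tree_memW k k.+1 _ (leqnSn k).
move: l; apply: (tree_ind tk) => [l lT c1|l lT c1 c2 h1 h2].
  rewrite (qval_unfold tk lT) (negbTE c1).
  apply: le_trans (qval_le_Etilde tS (ss _ lT)) _.
  exact: (Etilde_le (i := 0) (ss _ lT)).
rewrite (qval_unfold tk lT) c1 (qval_unfold tS (ss _ lT)) (ss _ c1).
rewrite le_min !ge_min ge_max !le_max h1 h2 /= orbT /=; apply/orP; right.
have r := rank_mono tk tS (tree_sub (leqnSn k)) lT.
rewrite [leRHS](Etilde_hist (leqnSn k) lT) //.
exact: (Etilde_le (ss _ lT)).
Qed.

Lemma qval_root_antimono i j : (i <= j)%N ->
  qval root e (hist j) root <= qval root e (hist i) root.
Proof.
elim: j => [|j IH]; first by rewrite leqn0 => /eqP ->.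
rewrite leq_eqVlt => /predU1P[->//|/IH]; apply: le_trans.
exact: qval_antimono (tree_root (tree_is_tree j)).
Qed.

End Greedy.

(** * Lower bound for the error of a competitor *)

Section NearBest.
Variables (R : realType) (root : windex) (e : nat -> windex -> R).
Variable tie : nat -> windex -> bool.
Hypothesis he : local_errors root e.
Implicit Types (T : {fset windex}) (l m : windex).
Local Notation is_tree := (is_tree R root).
Local Notation leaves := (leaves R).
Local Notation subtree := (subtree R).
Local Notation rank := (rank R).
Local Notation etilde := (etilde root e).
Local Notation hist := (history root e tie).
Local Notation tree := (nearbest_tree root e tie).
Local Notation threshold N := (qval root e (hist N) root).

Lemma qval_ge0 N l : l \in tree N -> 0 <= qval root e (hist N) l.
Proof.
have tN := tree_is_tree root e tie N : is_tree (tree N).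
move: l; apply: (tree_ind tN) => [l lT c1|l lT c1 c2 h1 h2];
  rewrite (qval_unfold e tN lT).
  by rewrite (negbTE c1) (etilde_ge0 he) ?(tree_below tN).
by rewrite c1 le_min le_max h1 (Etilde_ge0 he lT).
Qed.

Lemma threshold_ge0 N : 0 <= threshold N.
Proof. exact: qval_ge0 (tree_root (tree_is_tree root e tie N)). Qed.

(** Evaluate q at the step which gave [l] its final rank: there it is at most
    [Etilde] of the preceding rank and at least the final threshold. *)
Lemma err_ge_threshold N l p : l \in tree N ->
  ((rank l (tree N))%:R - p%:R) * threshold N <= e p l.
Proof.
move=> lN; have b := tree_below (tree_is_tree root e tie N) lN.
case: (leqP (rank l (tree N)) p) => [le|].
  apply: le_trans (err_ge0 he p b).
  by rewrite mulr_le0_ge0 ?threshold_ge0 // subr_le0 ler_nat.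
case E : (rank l (tree N)) => [//|r]; rewrite ltnS => pr.
have [k [kN lk rk bl]] := rank_increment lN E.
have [_ _ sq] := tree_selectP root e tie k.
have tk := tree_is_tree root e tie k : is_tree (tree k).
have := @Etilde_mul_le _ _ _ tie he k l p (r - p).
rewrite subnKC // rk => /(_ lk (leqnn _)); apply: le_trans.
rewrite -natrB ?(leqW pr) // subSn //; apply: ler_wpM2l => //.
apply: le_trans (qval_root_antimono tie he (ltnW kN)) _.
apply: le_trans (sq _ bl b) _.
by rewrite -rk; exact: qval_le_Etilde.
Qed.

(** A node at which T'_N stops earlier than the competitor has rank 0; the
    competitor pays at least 1 for the leaves below it. *)
Lemma sum_leaves_ge1 T (p : windex -> nat) l : is_tree T -> l \in T ->
  1 <= \sum_(m <- leaves (subtree l T)) (p m).+1%:R :> R.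
Proof.
move=> tT; move: l; apply: (tree_ind tT) => [l lT c1|l lT c1 c2 h1 h2];
  rewrite (big_leaves _ tT lT).
  by rewrite (negbTE c1) ler1n.
by rewrite c1; lra.
Qed.

(** The rank plus one is additive over children, like the sum over the leaves of
    the competitor; its leaves are treated by [err_ge_threshold]. *)
Lemma sum_leaves_err_ge N T (p : windex -> nat) l : is_tree T -> l \in T ->
  l \in tree N ->
  ((rank l (tree N)).+1%:R - \sum_(m <- leaves (subtree l T)) (p m).+1%:R)
    * threshold N <= \sum_(m <- leaves (subtree l T)) e (p m) m.
Proof.
move=> tT; have tN := tree_is_tree root e tie N : is_tree (tree N).
move: l; apply: (tree_ind tT) => [l lT c1|l lT c1 c2 h1 h2] lN.
  rewrite !(big_leaves _ tT lT) (negbTE c1).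
  have -> : (rank l (tree N)).+1%:R - (p l).+1%:R = (rank l (tree N))%:R - (p l)%:R :> R.
    by rewrite -!natr1; ring.
  exact: err_ge_threshold.
have s1 := sum_leaves_ge1 p tT c1; have s2 := sum_leaves_ge1 p tT c2.
case: (boolP (child1 l \in tree N)) => d1; last first.
  rewrite (rank_unfold tN lN) (negbTE d1).
  apply: (@le_trans _ _ 0).
    rewrite mulr_le0_ge0 ?threshold_ge0 // (big_leaves _ tT lT) c1.
    by move: s1 s2; lra.
  rewrite big_seq sumr_ge0 // => m; rewrite (mem_leaves_subtree _ _ tT) => /and3P[mT _ _].
  exact/(err_ge0 he)/(tree_below tT).
have d2 : child2 l \in tree N by rewrite (tree_children tN).
have := lerD (h1 d1) (h2 d2); rewrite !(big_leaves _ tT lT) c1 (rank_unfold tN lN) d1.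
apply: le_trans; rewrite -mulrDl ler_wpM2r ?threshold_ge0 //.
by rewrite -!natr1 natrD; lra.
Qed.

(** * Upper bound for the error of the algorithm *)

Lemma err_child c l : below l root -> (0 < c.1)%N -> parent c = l -> e 0%N c <= e 0%N l.
Proof.
move=> b c0 pc; apply: le_trans (err_children he b).
by case: (eq_child c0 pc) => ->;
  rewrite ?lerDl ?lerDr (err_ge0 he) ?below_child1_root ?below_child2_root.
Qed.

Lemma etilde_gt0 l : below l root -> 0 < e 0%N l -> 0 < etilde l.
Proof.
move: l; apply: below_ind => [|c l b b' c0 pc IH e0]; first by rewrite etilde_root.
rewrite (etilde_below e b c0 pc) hfrac_gt0 ?IH //.
exact: lt_le_trans e0 (err_child b c0 pc).
Qed.

(** The sum of 1/e_0 over the proper ancestors, as long as these errors are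
    positive. *)
Definition inv_above l : R := if l == root then 0 else (etilde (parent l))^-1.

Lemma inv_above_ge0 l : below l root -> 0 <= inv_above l.
Proof.
move=> b; rewrite /inv_above; case: eqVneq => // ne; rewrite invr_ge0 (etilde_ge0 he) //.
have lt : (root.1 < l.1)%N by rewrite -(below_lt b).
by move: b; rewrite below_parent ?(negbTE ne) //; lia.
Qed.

Lemma inv_above_child1 l : below l root -> inv_above (child1 l) = (etilde l)^-1.
Proof.
move=> b; rewrite /inv_above ifN ?parent_child1 //.
by rewrite (below_lt (below_child1_root b)) /= ltnS below_level.
Qed.

Lemma inv_above_child2 l : below l root -> inv_above (child2 l) = (etilde l)^-1.
Proof.
move=> b; rewrite /inv_above ifN ?parent_child2 //.
by rewrite (below_lt (below_child2_root b)) /= ltnS below_level.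
Qed.

(** 1/etilde(l) = 1/e_0(l) + [inv_above l] where e_0(l) is positive. *)
Lemma err_div_etilde l : below l root ->
  e 0%N l * (etilde l)^-1 <= 1 + e 0%N l * inv_above l.
Proof.
move=> b; have := err_ge0 he 0 b; rewrite le_eqVlt => /predU1P[<-|].
  by rewrite !mul0r addr0.
move=> e0; rewrite /inv_above; case: eqVneq => [E|ne].
  by rewrite E etilde_root mulr0 addr0 mulfV // gt_eqF // -E.
have lt : (root.1 < l.1)%N by rewrite -(below_lt b).
have l0 : (0 < l.1)%N by lia.
have bp : below (parent l) root by move: b; rewrite below_parent ?(negbTE ne).
have ep : 0 < etilde (parent l).
  by apply: etilde_gt0 => //; apply: lt_le_trans e0 (err_child bp l0 erefl).
by rewrite (etilde_below e bp l0 erefl) hfracV // mulrDr mulfV // gt_eqF.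
Qed.

(** Each summand 1/E_i(l) of 1/Etilde_j(l) is at most 1/E(l). *)
Lemma Etilde_inv_le N l j : l \in tree N -> (j <= rank l (tree N))%N ->
  0 < Etree e l (tree N) ->
  0 < Etilde root e (hist N) j l /\
  (Etilde root e (hist N) j l)^-1 <= j%:R / Etree e l (tree N) + (etilde l)^-1.
Proof.
move=> lN le E0; have tN := tree_is_tree root e tie N : is_tree (tree N).
have b := tree_below tN lN.
elim: j le => [|j IH] le /=.
  rewrite mul0r add0r lexx; split=> //; apply: etilde_gt0 => //.
  exact: lt_le_trans E0 (Etree_le_err0 he tN lN).
have [F0 F] := IH (ltnW le).
have EE : Etree e l (tree N) <= Estep e (hist N) j.+1 l.
  rewrite -(Estep_hist (leqnn N) lN erefl); exact: (Estep_le he lN le).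
have S0 := lt_le_trans E0 EE; split; first exact: hfrac_gt0.
rewrite hfracV // -natr1 mulrDl mul1r addrAC addrC lerD //.
by rewrite lef_pV2.
Qed.

Lemma Etree_le_Etilde N l t : l \in tree N ->
  Etilde root e (hist N) (rank l (tree N)) l <= t ->
  Etree e l (tree N) <= t * ((rank l (tree N))%:R + 1 + e 0%N l * inv_above l).
Proof.
move=> lN qt; have tN := tree_is_tree root e tie N : is_tree (tree N).
have b := tree_below tN lN; have t0 := le_trans (Etilde_ge0 he lN (leqnn _)) qt.
have a0 := inv_above_ge0 b; have e0 := err_ge0 he 0 b.
have := Etree_ge0 he tN lN; rewrite le_eqVlt => /predU1P[<-|E0].
  by rewrite mulr_ge0 // addr_ge0 ?mulr_ge0 ?addr_ge0.
have [F0 F] := Etilde_inv_le lN (leqnn _) E0.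
have t1 := lt_le_trans F0 qt.
have bd : t^-1 <= (rank l (tree N))%:R / Etree e l (tree N) + (etilde l)^-1.
  by apply: le_trans F; rewrite lef_pV2.
have Ee := Etree_le_err0 he tN lN.
have i0 : 0 <= (etilde l)^-1 by rewrite invr_ge0 (etilde_ge0 he).
rewrite -ler_pdivrMl //.
apply: le_trans (ler_wpM2r (ltW E0) bd) _.
rewrite mulrDl divfK ?gt_eqF // -addrA lerD2l mulrC.
exact: le_trans (ler_wpM2r i0 Ee) (err_div_etilde b).
Qed.

(** The term [e 0 l * inv_above l] is the share of the subtree below [l] in the
    sum of the fractions E/e_0 over the ancestors of [l].  Passing to the
    children, the shares add up to at most this term plus 1, for [l] itself;
    together with [rank l = rank l1 + rank l2 + 1] the bound is additive. *)
Lemma Etree_le_qval N l t : l \in tree N -> 0 <= t ->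
  qval root e (hist N) l <= t ->
  Etree e l (tree N) <= t * ((rank l (tree N)).*2.+1%:R + e 0%N l * inv_above l).
Proof.
move=> lN0 t0; have tN := tree_is_tree root e tie N : is_tree (tree N).
have weak m : m \in tree N ->
    Etilde root e (hist N) (rank m (tree N)) m <= t ->
    Etree e m (tree N) <= t * ((rank m (tree N)).*2.+1%:R + e 0%N m * inv_above m).
  move=> mN q; apply: le_trans (Etree_le_Etilde mN q) _.
  by rewrite ler_wpM2l // lerD2r natr1 ler_nat ltnS -addnn leq_addr.
move: l lN0 ; apply: (tree_ind tN) => [l lN c1|l lN c1 c2 h1 h2] q.
  apply: weak => //.
  by move: q; rewrite (qval_unfold e tN lN) (rank_unfold tN lN) (negbTE c1).
move: q; rewrite (qval_unfold e tN lN) c1 ge_min ge_max.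
case/orP=> [/andP[q1 q2]|]; last exact: weak.
have b := tree_below tN lN.
have := lerD (h1 q1) (h2 q2).
rewrite inv_above_child1 // inv_above_child2 // (rank_unfold tN lN) c1 => s.
rewrite (Etree_unfold e tN lN) c1; apply: le_trans (le_trans s _).
  by rewrite ge_min lexx.
have i0 : 0 <= (etilde l)^-1 by rewrite invr_ge0 (etilde_ge0 he).
rewrite -mulrDr ler_wpM2l //.
have := ler_wpM2r i0 (err_children he b); have := err_div_etilde b.
by rewrite -!addnn -!natr1 !natrD -!natr1 !natrD; lra.
Qed.

Lemma nearbest_error_le N :
  Etree e root (tree N) <= (2 * N%:R + 1) * threshold N.
Proof.
have rN := tree_root (tree_is_tree root e tie N : is_tree (tree N)).
have := Etree_le_qval rN (threshold_ge0 N) (lexx _).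
rewrite (rank_tree_root root e tie) /inv_above eqxx mulr0 addr0 mulrC.
by rewrite -natr1 -mul2n natrM.
Qed.

End NearBest.

(** * Conclusion *)

(** A leaf [l] lies in its own set [U l], and in that of no other leaf, since
    [U l'] consists of ancestors of [l'].  So the extended degree of a leaf is
    its given degree. *)
Lemma leaf_count_le_qcard (R : realType) (root : windex) (U : windex -> set windex)
    (Q : qtree) : is_upsilon R root U -> is_qtree R root Q ->
  (\sum_(l <- leaves R (qbase Q)) (qdeg Q l).+1 <= qcard R U Q)%N.
Proof.
case=> hU _ _ tQ; set S := qbase Q.
have pE l : l \in leaves R S -> pmax R U Q l = qdeg Q l.
  move=> lS; rewrite /pmax; congr (qdeg Q _).
  have lT : l \in S by move: lS; rewrite (mem_leaves _ tQ) => /andP[].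
  have [|l'S Ul'] := @xgetPex _ l [set l' | l' \in leaves R S /\ U l' l].
    exists l; split=> //.
    have [ml [d1 d2 ->]] := hU l (proj2 (desceqP _ _ _) (tree_below tQ lT)).
    by split=> //; right.
  set l' := xget _ _ in l'S Ul' *.
  have l'T : l' \in S by move: l'S; rewrite (mem_leaves _ tQ) => /andP[].
  have [ml [_ _ E]] := hU l' (proj2 (desceqP _ _ _) (tree_below tQ l'T)).
  move: Ul'; rewrite E => -[[d|//] _].
  by move: lS; rewrite !inE => /andP[_ /asboolP/(_ l' l'T)] /(_ d).
have -> : (qcard R U Q = \sum_(l <- S) (pmax R U Q l).+1)%N.
  rewrite /qcard -sum1_size -big_split /=; apply: eq_bigr => l _; exact: add1n.
rewrite [leqRHS](big_fsetID _ (fun l => l \in leaves R S)) /=.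
have -> : [fset x in S | x \in leaves R S]%fset = leaves R S.
  have sep (A : {fset windex}) (p : pred windex) m :
    (m \in [fset x in A | p x]%fset) = (m \in A) && p m by rewrite !inE.
  by apply/fsetP => m; rewrite sep (mem_leaves _ tQ) andbA andbb.
apply: leq_trans (leq_addr _ _).
by rewrite big_seq [leqRHS]big_seq; apply: leq_sum => l lS; rewrite pE.
Qed.

Theorem theorem3p7 (R : realType) (root : windex) (U : windex -> set windex)
    (hU : is_upsilon R root U)
    (n N : nat) (n_gt0 : (0 < n)%N) (le_nN : (n <= N)%N)
    (e : nat -> windex -> R) (he : local_errors root e)
    (tie : nat -> windex -> bool) :
  let T'N := nearbest_tree root e tie N in
  let TN := qtree_of R (trim e T'N) T'N in
  is_qtree R root TN /\
  qerror e TN <= (2 * N%:R + 1) / (N%:R - n%:R + 1) * sigma root U e n.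
Proof.
move=> T TN; have tT := tree_is_tree root e tie N : is_tree R root T.
split; first exact: trim_is_tree.
rewrite (trim_error e tT); apply: le_trans (nearbest_error_le tie he N) _.
have d0 : 0 < N%:R - n%:R + 1 :> R.
  by rewrite -natrB // natr1.
have p0 : 0 <= 2 * N%:R + 1 :> R by rewrite addr_ge0 ?mulr_ge0.
rewrite -mulrA ler_wpM2l // ler_pdivlMl //.
apply: lb_le_inf.
  exists (qerror e (QTree [fset root]%fset (fun=> 0%N))).
  exists (QTree [fset root]%fset (fun=> 0%N)) => //; split.
    exact: singleton_is_tree.
  by rewrite /qcard /pmax /= big1 // cardfs1.
move=> _ [Q [tQ cQ] <-].
have rQ := tree_root tQ; have rN := tree_root tT.
have := sum_leaves_err_ge he (qdeg Q) tQ rQ rN.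
rewrite (leaves_subtree_root tQ) -natr_sum (rank_tree_root root e tie).
apply: le_trans; rewrite ler_wpM2r ?threshold_ge0 //.
have := leq_trans (leaf_count_le_qcard hU tQ) cQ; rewrite -(ler_nat R).
by rewrite -natr1; lra.
Qed.
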